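(* Let $\Phi\subset\mathbb{R}^3$ be a skew ruled surface of class $C^3$, parametrized by $\boldsymbol{x}(u,v)=\boldsymbol{s}(u)+v\,\boldsymbol{e}(u)$, $(u,v)\in I\times\mathbb{R}$, as in the context, with conical curvature $k(u)$, distribution parameter $\delta(u)$ and $w=\sqrt{v^2+\delta(u)^2}$. Suppose that the normal curvature $k_N$ along the curves of constant striction distance (the curves $v=\text{const}$) has the form $$k_N=f(u)\,w^{n}\qquad\text{at every point }(u,v)\in I\times\mathbb{R},$$ with some $n\in\mathbb{Z}$ and some continuous function $f:I\to\mathbb{R}$. Then one of the following holds: (a) $f=0$ and $\Phi$ is a (right) helicoid. (b) $n=-1$, $f(u)=-k(u)$, and $\Phi$ is an orthoid of constant distribution parameter or an Edlinger surface.
   Context: Setting. $I\subset\mathbb{R}$ is an open interval and $\Phi$ is a regular ruled surface in Euclidean space $\mathbb{R}^3$ without torsal generators (''skew''), of class $C^3$ on $I\times\mathbb{R}$, with parametrization $\boldsymbol{x}(u,v)=\boldsymbol{s}(u)+v\,\boldsymbol{e}(u)$, where $\boldsymbol{s}$ is the striction line and $\boldsymbol{e}$ is the unit vector along the generators. Prime denotes $d/du$. It is assumed that $\langle \boldsymbol{s}'(u),\boldsymbol{e}'(u)\rangle=0$ and $|\boldsymbol{e}'(u)|=1$ for all $u\in I$. Moving frame: $\boldsymbol{n}:=\boldsymbol{e}'$, $\boldsymbol{z}:=\boldsymbol{e}\times\boldsymbol{n}$. Invariants (with $(\cdot,\cdot,\cdot)$ the triple product): conical curvature $k=(\boldsymbol{e},\boldsymbol{e}',\boldsymbol{e}'')$;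 distribution parameter (Drall) $\delta=(\boldsymbol{e},\boldsymbol{e}',\boldsymbol{s}')$, which is nowhere zero since $\Phi$ is skew; striction $\sigma$, the angle between $\boldsymbol{e}$ and $\boldsymbol{s}'$, and $\lambda:=\cot\sigma=\langle\boldsymbol{e},\boldsymbol{s}'\rangle/\delta$. Thus $\boldsymbol{s}'=\delta\lambda\,\boldsymbol{e}+\delta\,\boldsymbol{z}$. With $u^1=u$, $u^2=v$ and $w:=\sqrt{v^2+\delta^2}$, the fundamental forms (unit normal $(\boldsymbol{x}_u\times\boldsymbol{x}_v)/w$) are $g_{11}=v^2+\delta^2(\lambda^2+1)$, $g_{12}=\delta\lambda$, $g_{22}=1$, $h_{11}=-\frac1w\,[k v^2+\delta' v+\delta^2(k-\lambda)]$, $h_{12}=\frac{\delta}{w}$, $h_{22}=0$. The normal curvature in direction $du:dv$ is $k_N=\dfrac{h_{11}du^2+2h_{12}du\,dv+h_{22}dv^2}{g_{11}du^2+2g_{12}du\,dv+g_{22}dv^2}$; the normal curvature along a curve is that in its tangent direction. Terminology. $\Phi$ is an Edlinger surface if all its osculating quadrics are hyperboloids of revolution; equivalently, $\delta'=0$ and $k\lambda+1=0$ identically on $I$. $\Phi$ is an orthoid if $\lambda=0$ identically on $I$; it has constant distribution parameter if $\delta'=0$ identically. $\Phi$ is a (right) helicoid (Wendelfläche) if $k=\lambda=\delta'=0$ identically on $I$. ''$f=0$'' means that $f$ vanishes identically on $I$. *)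

(* Defs.v *)
From Stdlib Require Import Reals ZArith.
From Coquelicot Require Import Coquelicot.
Open Scope R_scope.

(** Euclidean three-space, with the [plus], [minus], [scal], [zero] that
    Coquelicot provides on products. *)

Definition vec : Type := (R * R * R)%type.

Definition px (p : vec) : R := fst (fst p).
Definition py (p : vec) : R := snd (fst p).
Definition pz (p : vec) : R := snd p.

Definition dot (p q : vec) : R := px p * px q + py p * py q + pz p * pz q.

Definition cross (p q : vec) : vec :=
  (py p * pz q - pz p * py q,
   pz p * px q - px p * pz q,
   px p * py q - py p * px q).

Definition triple (p q r : vec) : R := dot p (cross q r).

Definition vnorm (p : vec) : R := sqrt (dot p p).

Definition vDerive (c : R -> vec) (t : R) : vec :=
  (Derive (fun r => px (c r)) t,
   Derive (fun r => py (c r)) t,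
   Derive (fun r => pz (c r)) t).

(** [C^n] on a (meant to be open) set [D] of the parameter plane. *)
Fixpoint class_C (n : nat) (D : R -> R -> Prop) (f : R -> R -> R) : Prop :=
  match n with
  | O => forall u v, D u v -> continuity_2d_pt f u v
  | S m =>
      (forall u v, D u v ->
         ex_derive (fun t => f t v) u /\ ex_derive (fun t => f u t) v) /\
      class_C m D (fun u v => Derive (fun t => f t v) u) /\
      class_C m D (fun u v => Derive (fun t => f u t) v)
  end.

Definition class_C_vec (n : nat) (D : R -> R -> Prop) (X : R -> R -> vec) : Prop :=
  class_C n D (fun u v => px (X u v)) /\
  class_C n D (fun u v => py (X u v)) /\
  class_C n D (fun u v => pz (X u v)).

Definition in_Rbar_interval (a b : Rbar) (u : R) : Prop :=
  Rbar_lt a u /\ Rbar_lt u b.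

Definition D_u (X : R -> R -> vec) (u v : R) : vec := vDerive (fun t => X t v) u.
Definition D_v (X : R -> R -> vec) (u v : R) : vec := vDerive (fun t => X u t) v.

Definition unit_normal (X : R -> R -> vec) (u v : R) : vec :=
  let N := cross (D_u X u v) (D_v X u v) in scal (/ vnorm N) N.

Definition g11 (X : R -> R -> vec) (u v : R) : R := dot (D_u X u v) (D_u X u v).
Definition g12 (X : R -> R -> vec) (u v : R) : R := dot (D_u X u v) (D_v X u v).
Definition g22 (X : R -> R -> vec) (u v : R) : R := dot (D_v X u v) (D_v X u v).

Definition h11 (X : R -> R -> vec) (u v : R) : R :=
  dot (D_u (D_u X) u v) (unit_normal X u v).
Definition h12 (X : R -> R -> vec) (u v : R) : R :=
  dot (D_v (D_u X) u v) (unit_normal X u v).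
Definition h22 (X : R -> R -> vec) (u v : R) : R :=
  dot (D_v (D_v X) u v) (unit_normal X u v).

Definition normal_curvature (X : R -> R -> vec) (u v du dv : R) : R :=
  (h11 X u v * du ^ 2 + 2 * h12 X u v * du * dv + h22 X u v * dv ^ 2) /
  (g11 X u v * du ^ 2 + 2 * g12 X u v * du * dv + g22 X u v * dv ^ 2).

Definition ruled (s e : R -> vec) (u v : R) : vec := plus (s u) (scal v (e u)).

Definition conical_curvature (e : R -> vec) (u : R) : R :=
  triple (e u) (vDerive e u) (vDerive (vDerive e) u).

Definition drall (s e : R -> vec) (u : R) : R :=
  triple (e u) (vDerive e u) (vDerive s u).

(** The cotangent of the angle from [e] to [s'] (the striction). *)
Definition lambda (s e : R -> vec) (u : R) : R :=
  dot (e u) (vDerive s u) / drall s e u.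

(** [s] is the striction line by [srs_striction]; a generator is torsal exactly
    when the distribution parameter vanishes on it. *)
Record skew_ruled_surface (a b : Rbar) (s e : R -> vec) : Prop := {
  srs_C3 : class_C_vec 3 (fun u _ => in_Rbar_interval a b u) (ruled s e);
  srs_regular : forall u v, in_Rbar_interval a b u ->
    cross (D_u (ruled s e) u v) (D_v (ruled s e) u v) <> zero;
  srs_skew : forall u, in_Rbar_interval a b u -> drall s e u <> 0;
  srs_unit : forall u, in_Rbar_interval a b u -> vnorm (e u) = 1;
  srs_striction : forall u, in_Rbar_interval a b u ->
    dot (vDerive s u) (vDerive e u) = 0;
  srs_arclength : forall u, in_Rbar_interval a b u -> vnorm (vDerive e u) = 1
}.

Definition orthoid (a b : Rbar) (s e : R -> vec) : Prop :=
  forall u, in_Rbar_interval a b u -> lambda s e u = 0.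

Definition constant_drall (a b : Rbar) (s e : R -> vec) : Prop :=
  forall u, in_Rbar_interval a b u -> Derive (drall s e) u = 0.

Definition right_helicoid (a b : Rbar) (s e : R -> vec) : Prop :=
  forall u, in_Rbar_interval a b u ->
    conical_curvature e u = 0 /\ lambda s e u = 0 /\ Derive (drall s e) u = 0.

Record quadratic : Type := Quadratic {
  qxx : R; qyy : R; qzz : R; qxy : R; qxz : R; qyz : R;
  qx : R; qy : R; qz : R; q0 : R
}.

Definition qeval (q : quadratic) (p : vec) : R :=
  qxx q * px p ^ 2 + qyy q * py p ^ 2 + qzz q * pz p ^ 2
  + qxy q * (px p * py p) + qxz q * (px p * pz p) + qyz q * (py p * pz p)
  + qx q * px p + qy q * py p + qz q * pz p + q0 q.

Definition is_quadric (q : quadratic) : Prop :=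
  ~ (qxx q = 0 /\ qyy q = 0 /\ qzz q = 0 /\ qxy q = 0 /\ qxz q = 0 /\ qyz q = 0).

(** The osculating quadric along the generator [u] is the quadric through three
    consecutive generators, that is, having contact of order two with the
    surface along that generator.  Each of the three equations is a polynomial
    identity of degree two in [v], so these are nine homogeneous linear
    conditions on the ten coefficients; along a non-torsal generator the solution
    exists, and it is unique up to a factor. *)
Definition osculating_quadric (s e : R -> vec) (u : R) (q : quadratic) : Prop :=
  is_quadric q /\
  forall (v : R) (i : nat), (i <= 2)%nat ->
    Derive_n (fun t => qeval q (ruled s e t v)) i u = 0.

(** In cylindrical coordinates about an axis through the centre [c] with unit
    direction [d], the equation is [r^2/A^2 - h^2/B^2 = 1].  One sheet suffices:
    an osculating quadric contains real lines. *)
Definition hyperboloid_of_revolution (q : quadratic) : Prop :=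
  exists (c d : vec) (A B : R),
    vnorm d = 1 /\ 0 < A /\ 0 < B /\
    forall p : vec,
      let y := minus p c in
      let h := dot y d in
      qeval q p = 0 <-> (dot y y - h ^ 2) / A ^ 2 - h ^ 2 / B ^ 2 = 1.

Definition edlinger (a b : Rbar) (s e : R -> vec) : Prop :=
  forall u, in_Rbar_interval a b u ->
    forall q, osculating_quadric s e u q -> hyperboloid_of_revolution q.

(* Main.v *)
Require Import Defs.
From Corelib Require Import ssreflect.
From Stdlib Require Import Reals ZArith Lra Lia Ranalysis5.
From Coquelicot Require Import Coquelicot.
Open Scope R_scope.

(** In the moving frame [e], [n = e'], [z = e x n] the derivative equations
    [frame_equations] turn the hypothesis into the scalar identity
    [- (k v^2 + d' v + d^2 (k - l)) / (w (v^2 + d^2 (l^2 + 1))) = f w^n]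
    on every generator, where [w^2 = v^2 + d^2], [d] is the distribution
    parameter, [k] the conical curvature and [l] the cotangent of the striction
    ([normal_curvature_constant_distance]).

    On a single generator the identity is rigid ([power_law_coefficients]).
    The right-hand side is even in [v], so [d' = 0].  With [w = |d| r], [r >= 1],
    what remains is [k r^2 - l = - F r^(n+1) (r^2 + l^2)], where [F] is [f]
    times a nonzero constant.  Along [r = 1, 2, 4, 8] the left-hand side solves the
    linear recurrence with characteristic roots 4 and 1, and the right-hand side
    is a combination of geometric sequences of ratios [4 y] and [y], where
    [y = 2^(n+1)].  If [F <> 0], this leaves only [y = 1], that is [n = -1], and
    then [f = - k] and [l (1 + k l) = 0].  If [F = 0], then [k = l = 0].

    So either [f] vanishes on the whole interval and the surface is a right
    helicoid, or [n = -1], [f = - k] and [l (1 + k l) = 0] on every generator.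
    In the second case [k l] is [0] or [-1] at each point.  It equals [- f l],
    which is continuous, so it is one of the two constants
    ([continuous_nonvanishing_sign] applied to [k l + 1/2]).  If [k l = 0] the
    surface is an orthoid.  If [k l = -1], the equation of the osculating quadric
    in frame coordinates ([osculating_quadric_equation]) is, up to a factor,
    [k y^2 + (k - 1/k) z^2 - 2 x z + 2 d y = 0]; its quadratic part has the
    eigenvalues [k], [k], [-1/k], which makes it a hyperboloid of revolution
    ([hyperboloid_of_revolution_criterion]). *)

(** * Differentiation of curves *)

Definition is_vderive (c : R -> vec) (t : R) (l : vec) : Prop :=
  is_derive (fun r => px (c r)) t (px l) /\
  is_derive (fun r => py (c r)) t (py l) /\
  is_derive (fun r => pz (c r)) t (pz l).

Lemma vec_eta (p : vec) : p = (px p, py p, pz p).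
Proof. destruct p as [[x y] z]; reflexivity. Qed.

Lemma vec_ext (p q : vec) :
  px p = px q -> py p = py q -> pz p = pz q -> p = q.
Proof.
  destruct p as [[? ?] ?], q as [[? ?] ?]; unfold px, py, pz; simpl.
  intros -> -> ->; reflexivity.
Qed.

Lemma px_plus (p q : vec) : px (plus p q) = px p + px q.
Proof. reflexivity. Qed.
Lemma py_plus (p q : vec) : py (plus p q) = py p + py q.
Proof. reflexivity. Qed.
Lemma pz_plus (p q : vec) : pz (plus p q) = pz p + pz q.
Proof. reflexivity. Qed.
Lemma px_minus (p q : vec) : px (minus p q) = px p - px q.
Proof. reflexivity. Qed.
Lemma py_minus (p q : vec) : py (minus p q) = py p - py q.
Proof. reflexivity. Qed.
Lemma pz_minus (p q : vec) : pz (minus p q) = pz p - pz q.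
Proof. reflexivity. Qed.
Lemma px_scal (a : R) (p : vec) : px (scal a p) = a * px p.
Proof. reflexivity. Qed.
Lemma py_scal (a : R) (p : vec) : py (scal a p) = a * py p.
Proof. reflexivity. Qed.
Lemma pz_scal (a : R) (p : vec) : pz (scal a p) = a * pz p.
Proof. reflexivity. Qed.
Lemma px_cross (p q : vec) : px (cross p q) = py p * pz q - pz p * py q.
Proof. reflexivity. Qed.
Lemma py_cross (p q : vec) : py (cross p q) = pz p * px q - px p * pz q.
Proof. reflexivity. Qed.
Lemma pz_cross (p q : vec) : pz (cross p q) = px p * py q - py p * px q.
Proof. reflexivity. Qed.

Ltac coords :=
  rewrite ?(px_plus, py_plus, pz_plus, px_minus, py_minus, pz_minus,
    px_scal, py_scal, pz_scal, px_cross, py_cross, pz_cross).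
(* [ring] needs the carrier of an equation to be [R] syntactically, and not the
   carrier of a module structure on it. *)
Ltac Rring := lazymatch goal with |- ?x = ?y => change (@eq R x y); ring end.
Ltac vring := unfold triple, dot; coords; ring.
Ltac vec_ring := apply vec_ext; coords; ring.

Lemma is_vderive_unique (c : R -> vec) (t : R) (l : vec) :
  is_vderive c t l -> vDerive c t = l.
Proof.
  intros (Hx & Hy & Hz); unfold vDerive.
  rewrite (is_derive_unique _ _ _ Hx) (is_derive_unique _ _ _ Hy)
    (is_derive_unique _ _ _ Hz).
  symmetry; apply vec_eta.
Qed.

Lemma is_vderive_ext_loc (c d : R -> vec) (t : R) (l : vec) :
  locally t (fun r => c r = d r) -> is_vderive c t l -> is_vderive d t l.
Proof.
  intros H (Hx & Hy & Hz).
  split; [| split]; (eapply is_derive_ext_loc; [| eassumption]);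
    revert H; apply filter_imp; intros r ->; reflexivity.
Qed.

Lemma is_derive_eq (h : R -> R) (t l l' : R) :
  is_derive h t l -> l = l' -> is_derive h t l'.
Proof. intros H <-; exact H. Qed.

Lemma is_derive_Rmult (g h : R -> R) (t dg dh : R) :
  is_derive g t dg -> is_derive h t dh ->
  is_derive (fun r => g r * h r) t (dg * h t + g t * dh).
Proof. intros Hg Hh; apply (is_derive_mult g h t); auto; exact Rmult_comm. Qed.

Lemma is_derive_dot (c d : R -> vec) (t : R) (c' d' : vec) :
  is_vderive c t c' -> is_vderive d t d' ->
  is_derive (fun r => dot (c r) (d r)) t (dot c' (d t) + dot (c t) d').
Proof.
  intros (Cx & Cy & Cz) (Dx & Dy & Dz); unfold dot.
  eapply is_derive_eq.
  - apply: is_derive_plus; [apply: is_derive_plus |]; apply is_derive_Rmult;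
      eassumption.
  - unfold plus; simpl; ring.
Qed.

Lemma is_vderive_cross (c d : R -> vec) (t : R) (c' d' : vec) :
  is_vderive c t c' -> is_vderive d t d' ->
  is_vderive (fun r => cross (c r) (d r)) t (plus (cross c' (d t)) (cross (c t) d')).
Proof.
  intros (Cx & Cy & Cz) (Dx & Dy & Dz).
  split; [| split]; (eapply is_derive_eq;
    [apply: is_derive_minus; apply is_derive_Rmult; eassumption
    | coords; unfold minus, plus, opp; simpl; ring]).
Qed.

Lemma is_vderive_ruled (s e : R -> vec) (u v : R) (s' e' : vec) :
  is_vderive s u s' -> is_vderive e u e' ->
  is_vderive (fun t => ruled s e t v) u (plus s' (scal v e')).
Proof.
  intros (Sx & Sy & Sz) (Ex & Ey & Ez); unfold ruled.
  split; [| split];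
    (apply: is_derive_plus; [assumption | apply: is_derive_scal; assumption]).
Qed.

Lemma is_vderive_generator (s e : R -> vec) (u v : R) :
  is_vderive (fun t => ruled s e u t) v (e u).
Proof.
  unfold ruled; split; [| split]; coords; (eapply is_derive_eq;
    [apply: is_derive_plus; [apply is_derive_const |
       apply is_derive_Rmult; [apply is_derive_id | apply is_derive_const]]
    | unfold plus, zero, one, px, py, pz; simpl; ring]).
Qed.

(** * Regularity *)

Lemma locally_in_interval (a b : Rbar) (u : R) :
  in_Rbar_interval a b u -> locally u (in_Rbar_interval a b).
Proof.
  intros [Ha Hb].
  apply (open_and (fun u : R => Rbar_lt a u) (fun u : R => Rbar_lt u b));
    [apply open_Rbar_gt | apply open_Rbar_lt |]; auto.
Qed.

(** The generator coordinate ranges over all of [R], so a directrix and the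
    direction field can be recovered from the values at [v = 0] and [v = 1]. *)
Lemma ruled_component_regular (a b : Rbar) (g h : R -> R) :
  class_C 3 (fun u _ => in_Rbar_interval a b u) (fun u v => g u + v * h u) ->
  forall u, in_Rbar_interval a b u ->
  (ex_derive g u /\ ex_derive (Derive g) u) /\
  (ex_derive h u /\ ex_derive (Derive h) u).
Proof.
  intros (H1 & (H2 & _ & _) & _).
  assert (G1 : forall u, in_Rbar_interval a b u -> ex_derive g u).
  { intros u Hu; apply (ex_derive_ext (fun t => g t + 0 * h t)); [intros t; Rring |].
    apply (H1 u 0 Hu). }
  assert (K1 : forall u, in_Rbar_interval a b u -> ex_derive h u).
  { intros u Hu; apply (ex_derive_ext (fun t => (g t + 1 * h t) - g t));
      [intros t; Rring |].
    apply: ex_derive_minus; [apply (H1 u 1 Hu) | auto]. }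
  assert (G2 : forall u, in_Rbar_interval a b u -> ex_derive (Derive g) u).
  { intros u Hu; apply (ex_derive_ext (fun t => Derive (fun r => g r + 0 * h r) t)).
    - intros t; apply Derive_ext; intros r; Rring.
    - apply (H2 u 0 Hu). }
  intros u Hu; split; [split; auto | split; auto].
  apply (ex_derive_ext_loc
    (fun t => Derive (fun r => g r + 1 * h r) t - Derive g t)).
  - generalize (locally_in_interval a b u Hu); apply filter_imp; intros t Ht.
    rewrite (Derive_ext (fun r => g r + 1 * h r) (fun r => g r + h r));
      [| intros r; Rring].
    rewrite Derive_plus; auto; Rring.
  - apply: ex_derive_minus; [apply (H2 u 1 Hu) | auto].
Qed.

Lemma surface_regular (a b : Rbar) (s e : R -> vec) :
  class_C_vec 3 (fun u _ => in_Rbar_interval a b u) (ruled s e) ->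
  forall u, in_Rbar_interval a b u ->
  (is_vderive s u (vDerive s u) /\
   is_vderive (vDerive s) u (vDerive (vDerive s) u)) /\
  (is_vderive e u (vDerive e u) /\
   is_vderive (vDerive e) u (vDerive (vDerive e) u)).
Proof.
  intros (Hx & Hy & Hz) u Hu.
  destruct (ruled_component_regular a b (fun t => px (s t)) (fun t => px (e t)) Hx u Hu)
    as [[? ?] [? ?]].
  destruct (ruled_component_regular a b (fun t => py (s t)) (fun t => py (e t)) Hy u Hu)
    as [[? ?] [? ?]].
  destruct (ruled_component_regular a b (fun t => pz (s t)) (fun t => pz (e t)) Hz u Hu)
    as [[? ?] [? ?]].
  repeat split; apply Derive_correct; assumption.
Qed.

(** * Orthonormal frames *)

Lemma dot_comm (p q : vec) : dot p q = dot q p.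
Proof. vring. Qed.

Definition orthonormal (e n : vec) : Prop :=
  dot e e = 1 /\ dot n n = 1 /\ dot e n = 0.

(** By the Cauchy-Binet formula the last product is the Gram determinant of
    [e, n, p] against [e, n, q]. *)
Lemma dot_frame (e n p q : vec) : orthonormal e n ->
  dot p q = dot p e * dot q e + dot p n * dot q n
            + dot p (cross e n) * dot q (cross e n).
Proof.
  intros (He & Hn & Hen).
  assert (G : dot p (cross e n) * dot q (cross e n) =
    dot e e * (dot n n * dot p q - dot n q * dot p n)
    - dot e n * (dot e n * dot p q - dot n q * dot p e)
    + dot e q * (dot e n * dot p n - dot n n * dot p e)) by vring.
  rewrite G He Hn Hen (dot_comm e q) (dot_comm n q); ring.
Qed.

Lemma dot_nondegenerate (p q : vec) : (forall r, dot p r = dot q r) -> p = q.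
Proof.
  intros H; apply vec_ext;
    [generalize (H (1, 0, 0)) | generalize (H (0, 1, 0)) | generalize (H (0, 0, 1))];
    unfold dot; simpl; unfold px, py, pz; simpl; lra.
Qed.

Definition in_frame (e n : vec) (x y z : R) : vec :=
  plus (plus (scal x e) (scal y n)) (scal z (cross e n)).

Lemma frame_decomposition (e n p : vec) : orthonormal e n ->
  p = in_frame e n (dot p e) (dot p n) (dot p (cross e n)).
Proof.
  intros H; apply dot_nondegenerate; intros q.
  rewrite (dot_frame e n p q H) /in_frame.
  generalize (dot p e) (dot p n) (dot p (cross e n)); intros; vring.
Qed.

Lemma dot_in_frame (e n : vec) (x y z x' y' z' : R) : orthonormal e n ->
  dot (in_frame e n x y z) (in_frame e n x' y' z') = x * x' + y * y' + z * z'.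
Proof.
  intros (He & Hn & Hen).
  assert (G : dot (in_frame e n x y z) (in_frame e n x' y' z') =
    x * x' * dot e e + y * y' * dot n n + (x * y' + y * x') * dot e n
    + z * z' * (dot e e * dot n n - dot e n ^ 2)) by (unfold in_frame; vring).
  rewrite G He Hn Hen; ring.
Qed.

Lemma cross_in_frame (e n : vec) (x y z : R) : orthonormal e n ->
  cross (in_frame e n x y z) e = in_frame e n 0 z (- y).
Proof.
  intros (He & Hn & Hen).
  assert (G : cross (in_frame e n x y z) e =
    plus (scal (z * dot e e) n) (plus (scal (- (z * dot e n)) e) (scal (- y) (cross e n))))
    by (unfold in_frame, dot; vec_ring).
  rewrite G He Hen /in_frame; vec_ring.
Qed.

Lemma in_frame_plus_scal (e n : vec) (x y z v x' y' z' : R) :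
  plus (in_frame e n x y z) (scal v (in_frame e n x' y' z'))
  = in_frame e n (x + v * x') (y + v * y') (z + v * z').
Proof. unfold in_frame; vec_ring. Qed.

Lemma dot_scal_r (p q : vec) (a : R) : dot p (scal a q) = a * dot p q.
Proof. vring. Qed.

(** * The moving frame and the normal curvature *)

Lemma is_derive_locally_const (h : R -> R) (u c l : R) :
  locally u (fun t => h t = c) -> is_derive h u l -> l = 0.
Proof.
  intros H D; rewrite -(is_derive_unique _ _ _ D).
  rewrite (Derive_ext_loc h (fun _ => c) u H); apply Derive_const.
Qed.

Lemma vnorm_one (p : vec) : vnorm p = 1 -> dot p p = 1.
Proof.
  unfold vnorm; intros H.
  destruct (Rle_lt_dec 0 (dot p p)) as [Hp | Hp].
  - rewrite -(sqrt_sqrt _ Hp) H; ring.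
  - rewrite sqrt_neg_0 in H; lra.
Qed.

(** The components of [e''] and [s''] are read off by differentiating one of the constant inner
    products [<e, e>], [<e, n>], [<n, n>], [<s', n>], or the triple product
    that defines the distribution parameter.  The [e]-component of [s''] stays
    implicit: it involves [l'], and it is tangent to the generator, so neither
    the normal curvature nor the osculating quadric depends on it. *)
Lemma frame_equations (a b : Rbar) (s e : R -> vec) (u : R) :
  skew_ruled_surface a b s e -> in_Rbar_interval a b u ->
  let E := e u in let N := vDerive e u in
  let k := conical_curvature e u in
  let d := drall s e u in
  let l := lambda s e u in
  orthonormal E N /\
  vDerive s u = in_frame E N (d * l) 0 d /\
  vDerive (vDerive e) u = in_frame E N (-1) 0 k /\
  vDerive (vDerive s) u =
    in_frame E N (dot (vDerive (vDerive s) u) E) (d * (l - k)) (Derive (drall s e) u) /\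
  ex_derive (lambda s e) u.
Proof.
  intros [HC _ Hsk Hun Hst Har] Hu E N k d l.
  destruct (surface_regular a b s e HC u Hu) as [[S1 S2] [E1 E2]].
  pose proof (locally_in_interval a b u Hu) as Lu.
  assert (EE : dot E E = 1) by (apply vnorm_one, Hun, Hu).
  assert (NN : dot N N = 1) by (apply vnorm_one, Har, Hu).
  assert (EN : dot E N = 0).
  { enough (dot N E + dot E N = 0) by (rewrite (dot_comm N E) in H; lra).
    eapply (is_derive_locally_const (fun t => dot (e t) (e t)) u 1);
      [| apply is_derive_dot; exact E1].
    revert Lu; apply filter_imp; intros t Ht; apply vnorm_one; auto. }
  assert (FR : orthonormal E N) by (repeat split; assumption).
  set (e2 := vDerive (vDerive e) u) in *.
  set (s1 := vDerive s u) in *.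
  set (s2 := vDerive (vDerive s) u) in *.
  assert (NE2 : dot e2 N = 0).
  { enough (dot e2 N + dot N e2 = 0) by (rewrite (dot_comm N e2) in H; lra).
    eapply (is_derive_locally_const (fun t => dot (vDerive e t) (vDerive e t)) u 1);
      [| apply is_derive_dot; exact E2].
    revert Lu; apply filter_imp; intros t Ht; apply vnorm_one; auto. }
  assert (EE2 : dot e2 E = -1).
  { enough (dot N N + dot E e2 = 0) by (rewrite (dot_comm E e2) in H; lra).
    eapply (is_derive_locally_const (fun t => dot (e t) (vDerive e t)) u 0);
      [| apply is_derive_dot; [exact E1 | exact E2]].
    revert Lu; apply filter_imp; intros t Ht.
    enough (dot (vDerive e t) (e t) + dot (e t) (vDerive e t) = 0)
      by (rewrite (dot_comm (vDerive e t)) in H; lra).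
    eapply (is_derive_locally_const (fun t => dot (e t) (e t)) t 1);
      [| apply is_derive_dot; exact (proj1 (proj2 (surface_regular a b s e HC t Ht)))].
    generalize (locally_in_interval a b t Ht); apply filter_imp; intros r Hr.
    apply vnorm_one; auto. }
  assert (He2 : e2 = in_frame E N (-1) 0 k).
  { rewrite {1}(frame_decomposition E N e2 FR) EE2 NE2; f_equal.
    unfold k, conical_curvature; fold E N e2; vring. }
  assert (Hs1 : s1 = in_frame E N (d * l) 0 d).
  { rewrite {1}(frame_decomposition E N s1 FR); f_equal.
    - unfold l, lambda; fold E s1 d; rewrite (dot_comm E s1); field; apply Hsk, Hu.
    - apply Hst, Hu.
    - unfold d, drall; fold E N s1; vring. }
  assert (Dd : is_derive (drall s e) u (dot N (cross N s1)
    + dot E (plus (cross e2 s1) (cross N s2)))).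
  { unfold drall, triple; apply is_derive_dot; [exact E1 |].
    apply is_vderive_cross; [exact E2 | exact S2]. }
  repeat split; auto.
  - rewrite {1}(frame_decomposition E N s2 FR); f_equal.
    + assert (H : dot s2 N + dot s1 e2 = 0).
      { eapply (is_derive_locally_const (fun t => dot (vDerive s t) (vDerive e t)) u 0);
          [| apply is_derive_dot; [exact S2 | exact E2]].
        revert Lu; apply filter_imp; auto. }
      rewrite He2 Hs1 dot_in_frame in H; auto; lra.
    + rewrite (is_derive_unique _ _ _ Dd).
      (* e, e'' and s' lie in the plane orthogonal to n *)
      assert (H : dot E (cross e2 s1) = 0) by (rewrite He2 Hs1 /in_frame; vring).
      transitivity (dot E (cross e2 s1) + dot s2 (cross E N)); [rewrite H; ring | vring].
  - unfold lambda; apply: ex_derive_div.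
    + eexists; apply is_derive_dot; [exact E1 | exact S2].
    + eexists; exact Dd.
    + apply Hsk; auto.
Qed.

(** In frame coordinates [x_u = (d l, v, d)], hence [x_u x e = (0, d, - v)], and
    this vector has length [w]. *)
Lemma normal_curvature_constant_distance (a b : Rbar) (s e : R -> vec) (u v : R) :
  skew_ruled_surface a b s e -> in_Rbar_interval a b u ->
  let k := conical_curvature e u in
  let d := drall s e u in
  let l := lambda s e u in
  normal_curvature (ruled s e) u v 1 0 =
  - (k * v ^ 2 + Derive (drall s e) u * v + d ^ 2 * (k - l))
  / (sqrt (v ^ 2 + d ^ 2) * (v ^ 2 + d ^ 2 * (l ^ 2 + 1))).
Proof.
  intros HP Hu k d l.
  destruct (frame_equations a b s e u HP Hu) as (FR & Hs1 & He2 & Hs2 & _).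
  fold k d l in Hs1, He2, Hs2.
  pose proof (srs_skew _ _ _ _ HP u Hu) as Hd; fold d in Hd.
  pose proof (surface_regular a b s e (srs_C3 _ _ _ _ HP)) as Reg.
  assert (Xu : forall t, in_Rbar_interval a b t ->
    D_u (ruled s e) t v = plus (vDerive s t) (scal v (vDerive e t))).
  { intros t Ht; destruct (Reg t Ht) as [[S1 _] [E1 _]].
    exact (is_vderive_unique _ _ _ (is_vderive_ruled _ _ t v _ _ S1 E1)). }
  assert (Xv : D_v (ruled s e) u v = e u)
    by exact (is_vderive_unique _ _ _ (is_vderive_generator s e u v)).
  assert (Xuu : D_u (D_u (ruled s e)) u v =
    plus (vDerive (vDerive s) u) (scal v (vDerive (vDerive e) u))).
  { destruct (Reg u Hu) as [[_ S2] [_ E2]].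
    apply is_vderive_unique.
    apply (is_vderive_ext_loc (fun t => ruled (vDerive s) (vDerive e) t v)).
    - generalize (locally_in_interval a b u Hu); apply filter_imp; intros t Ht.
      rewrite Xu; auto.
    - exact (is_vderive_ruled _ _ u v _ _ S2 E2). }
  unfold normal_curvature, h11, g11, unit_normal.
  rewrite Xuu (Xu u Hu) Xv Hs1 He2 Hs2.
  set (N := vDerive e u) in *; set (E := e u) in *.
  set (b' := dot (vDerive (vDerive s) u) E).
  replace (plus (in_frame E N (d * l) 0 d) (scal v N)) with (in_frame E N (d * l) v d)
    by (unfold in_frame; vec_ring).
  rewrite in_frame_plus_scal (cross_in_frame _ _ _ _ _ FR) dot_scal_r.
  rewrite !(dot_in_frame _ _ _ _ _ _ _ _ FR) /vnorm (dot_in_frame _ _ _ _ _ _ _ _ FR).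
  replace (0 * 0 + d * d + - v * - v) with (v ^ 2 + d ^ 2) by ring.
  assert (Hw : 0 < sqrt (v ^ 2 + d ^ 2)) by (apply sqrt_lt_R0; nra).
  assert (Hg : 0 < v ^ 2 + d ^ 2 * (l ^ 2 + 1)) by nra.
  field; repeat split; nra.
Qed.

(** * Normal curvature proportional to a power of w *)

Lemma powerRZ_two_one (m : Z) : powerRZ 2 m = 1 -> m = 0%Z.
Proof.
  intros H; rewrite powerRZ_Rpower in H; [| lra].
  unfold Rpower in H; rewrite -exp_0 in H; apply exp_inv in H.
  assert (L : 0 < ln 2) by (rewrite -ln_1; apply ln_increasing; lra).
  apply eq_IZR; nra.
Qed.

(** The points [v = |d| sqrt (4^j - 1)], at which [w = |d| 2^j], turn the unknown
    power of [w] into a geometric sequence in [j]; its first four terms already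
    determine everything. *)
Lemma power_law_coefficients (k d d' l f : R) (n : Z) : d <> 0 ->
  (forall v, - (k * v ^ 2 + d' * v + d ^ 2 * (k - l))
     / (sqrt (v ^ 2 + d ^ 2) * (v ^ 2 + d ^ 2 * (l ^ 2 + 1)))
     = f * powerRZ (sqrt (v ^ 2 + d ^ 2)) n) ->
  d' = 0 /\
  ((f = 0 /\ k = 0 /\ l = 0) \/
   (n = (-1)%Z /\ f = - k /\ l * (1 + k * l) = 0)).
Proof.
  intros Hd H.
  assert (Hd2 : 0 < d ^ 2) by nra.
  (* both sides at v = 1 and v = -1: the right-hand sides agree *)
  assert (Hd' : d' = 0).
  { generalize (H 1) (H (-1)); replace ((-1) ^ 2) with (1 ^ 2) by ring.
    assert (0 < sqrt (1 ^ 2 + d ^ 2)) by (apply sqrt_lt_R0; lra).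
    assert (0 < 1 ^ 2 + d ^ 2 * (l ^ 2 + 1)) by nra.
    intros <- E; revert E; set (w := sqrt _) in *; set (g := _ + _ * (_ + 1)) in *.
    intros E; apply (f_equal (fun x => x * (w * g))) in E.
    field_simplify in E; lra. }
  split; [exact Hd' |]; subst d'.
  set (F := f * powerRZ (Rabs d) n * Rabs d).
  assert (Ha : 0 < Rabs d) by (apply Rabs_pos_lt; exact Hd).
  assert (Ha2 : Rabs d ^ 2 = d ^ 2) by (rewrite RPow_abs Rabs_pos_eq; lra).
  assert (S : forall r, 1 <= r ->
    k * r ^ 2 - l = - (F * (r * powerRZ r n) * (r ^ 2 + l ^ 2))).
  { intros r Hr.
    assert (Hs : sqrt (r ^ 2 - 1) ^ 2 = r ^ 2 - 1) by (apply pow2_sqrt; nra).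
    specialize (H (Rabs d * sqrt (r ^ 2 - 1))).
    assert (Hv : (Rabs d * sqrt (r ^ 2 - 1)) ^ 2 = d ^ 2 * (r ^ 2 - 1))
      by (rewrite Rpow_mult_distr Ha2 Hs; ring).
    rewrite Hv in H.
    assert (Hw : sqrt (d ^ 2 * (r ^ 2 - 1) + d ^ 2) = Rabs d * r).
    { replace (d ^ 2 * (r ^ 2 - 1) + d ^ 2) with ((Rabs d * r) ^ 2)
        by (rewrite Rpow_mult_distr Ha2; ring).
      apply sqrt_pow2; nra. }
    rewrite Hw powerRZ_mult in H.
    assert (Hg : 0 < r ^ 2 + l ^ 2) by nra.
    assert (K : - (k * (d ^ 2 * (r ^ 2 - 1)) + 0 * (Rabs d * sqrt (r ^ 2 - 1)) + d ^ 2 * (k - l))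
       / (Rabs d * r * (d ^ 2 * (r ^ 2 - 1) + d ^ 2 * (l ^ 2 + 1)))
       = - ((k * r ^ 2 - l) / (Rabs d * r * (r ^ 2 + l ^ 2)))).
    { field; repeat split; nra. }
    rewrite K in H; unfold F.
    replace (f * powerRZ (Rabs d) n * Rabs d * (r * powerRZ r n) * (r ^ 2 + l ^ 2))
      with (f * (powerRZ (Rabs d) n * powerRZ r n) * (Rabs d * r * (r ^ 2 + l ^ 2))) by ring.
    rewrite -H; field; repeat split; nra. }
  set (y := 2 * powerRZ 2 n).
  assert (Hy : 0 < y) by (unfold y; generalize (powerRZ_lt 2 n); lra).
  assert (S1 : k - l = - (F * (1 + l ^ 2))).
  { generalize (S 1 (Rle_refl 1)); replace (powerRZ 1 n) with 1; [lra |].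
    symmetry; apply powerRZ_R1. }
  assert (S2 : 4 * k - l = - (F * y * (4 + l ^ 2))).
  { generalize (S 2 ltac:(lra)); unfold y; generalize (powerRZ 2 n); intros; lra. }
  assert (S4 : 16 * k - l = - (F * y ^ 2 * (16 + l ^ 2))).
  { generalize (S (2 * 2) ltac:(lra)); rewrite powerRZ_mult; unfold y.
    generalize (powerRZ 2 n); intros; lra. }
  assert (S8 : 64 * k - l = - (F * y ^ 3 * (64 + l ^ 2))).
  { generalize (S (2 * (2 * 2)) ltac:(lra)); rewrite !powerRZ_mult; unfold y.
    generalize (powerRZ 2 n); intros; lra. }
  destruct (Req_dec f 0) as [Hf | Hf].
  { left; assert (HF : F = 0) by (unfold F; rewrite Hf; ring).
    rewrite HF in S1 S2; repeat split; lra. }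
  assert (HF : F <> 0).
  { generalize (powerRZ_lt _ n Ha); intros Hp.
    unfold F; repeat apply Rmult_integral_contrapositive_currified; lra. }
  right.
  (* The sequence 4^j k - l is annihilated by (T - 4) (T - 1), T being the shift;
     R1 and R2 express this for the right-hand sides at j = 0 and j = 1. *)
  assert (R1 : (4 * y - 1) * (4 * y - 4) + l ^ 2 * ((y - 1) * (y - 4)) = 0).
  { apply (Rmult_eq_reg_l F); [| exact HF]; lra. }
  assert (R2 : (4 * y) * (4 * y - 1) * (4 * y - 4) + l ^ 2 * (y * ((y - 1) * (y - 4))) = 0).
  { apply (Rmult_eq_reg_l F); [| exact HF]; lra. }
  (* R2 - y R1, divided by 12 y *)
  assert (R3 : (4 * y - 1) * (y - 1) = 0) by nra.
  destruct (Rmult_integral _ _ R3) as [Hq | Hq].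
  - (* y = 1/4, that is n = -3: R1 gives l = 0, and then k r^2 would be constant *)
    exfalso.
    assert (y = / 4) as Ey by lra; rewrite Ey in R1 S2.
    assert (l = 0) as El by nra; subst l.
    apply HF; lra.
  - assert (Ey : y = 1) by lra.
    assert (Hn : n = (-1)%Z).
    { enough (n + 1 = 0)%Z by lia.
      apply powerRZ_two_one; rewrite powerRZ_add; [| lra].
      unfold y in Ey; simpl (powerRZ 2 1); lra. }
    assert (EF : F = f).
    { unfold F; rewrite Hn; simpl; field; lra. }
    rewrite Ey EF in S2; rewrite EF in S1.
    assert (f = - k) as -> by lra.
    repeat split; auto; lra.
Qed.

(** * Osculating quadrics *)

(** The symmetric bilinear form of the quadratic part. *)
Definition polar (q : quadratic) (p r : vec) : R :=
  qxx q * (px p * px r) + qyy q * (py p * py r) + qzz q * (pz p * pz r)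
  + qxy q * (px p * py r + py p * px r) / 2
  + qxz q * (px p * pz r + pz p * px r) / 2
  + qyz q * (py p * pz r + pz p * py r) / 2.

Definition differential (q : quadratic) (p r : vec) : R :=
  2 * polar q p r + (qx q * px r + qy q * py r + qz q * pz r).

Lemma qeval_plus (q : quadratic) (p r : vec) :
  qeval q (plus p r) = qeval q p + differential q p r + polar q r r.
Proof. unfold qeval, differential, polar; coords; field. Qed.

Lemma differential_plus (q : quadratic) (p w r : vec) :
  differential q (plus p w) r = differential q p r + 2 * polar q w r.
Proof. unfold differential, polar; coords; field. Qed.

Lemma differential_in_frame (q : quadratic) (p e n : vec) (x y z : R) :
  differential q p (in_frame e n x y z) =
  x * differential q p e + y * differential q p n + z * differential q p (cross e n).
Proof.
  unfold in_frame; generalize (cross e n); intros m.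
  unfold differential, polar; coords; field.
Qed.

Lemma polar_in_frame (q : quadratic) (e n : vec) (x y z x' y' z' : R) :
  polar q (in_frame e n x y z) (in_frame e n x' y' z') =
  x * x' * polar q e e + y * y' * polar q n n
  + z * z' * polar q (cross e n) (cross e n)
  + (x * y' + y * x') * polar q e n + (x * z' + z * x') * polar q e (cross e n)
  + (y * z' + z * y') * polar q n (cross e n).
Proof.
  unfold in_frame; generalize (cross e n); intros m.
  unfold polar; coords; field.
Qed.

Lemma is_derive_qeval (q : quadratic) (c : R -> vec) (t : R) (c' : vec) :
  is_vderive c t c' ->
  is_derive (fun r => qeval q (c r)) t (differential q (c t) c').
Proof.
  assert (G : forall (X Y Z : R -> R) X' Y' Z',
    is_derive X t X' -> is_derive Y t Y' -> is_derive Z t Z' ->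
    is_derive (fun r => qeval q (X r, Y r, Z r)) t
      (differential q (X t, Y t, Z t) (X', Y', Z'))).
  { intros X Y Z X' Y' Z' HX HY HZ.
    unfold qeval, differential, polar, px, py, pz; simpl fst; simpl snd.
    auto_derive.
    - repeat split; eexists; eassumption.
    - rewrite (is_derive_unique _ _ _ HX) (is_derive_unique _ _ _ HY)
        (is_derive_unique _ _ _ HZ); field. }
  intros (Hx & Hy & Hz); exact (G _ _ _ _ _ _ Hx Hy Hz).
Qed.

Lemma is_derive_differential (q : quadratic) (c d : R -> vec) (t : R) (c' d' : vec) :
  is_vderive c t c' -> is_vderive d t d' ->
  is_derive (fun r => differential q (c r) (d r)) t
    (2 * polar q c' (d t) + differential q (c t) d').
Proof.
  assert (G : forall (X Y Z U V W : R -> R) X' Y' Z' U' V' W',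
    is_derive X t X' -> is_derive Y t Y' -> is_derive Z t Z' ->
    is_derive U t U' -> is_derive V t V' -> is_derive W t W' ->
    is_derive (fun r => differential q (X r, Y r, Z r) (U r, V r, W r)) t
      (2 * polar q (X', Y', Z') (U t, V t, W t)
       + differential q (X t, Y t, Z t) (U', V', W'))).
  { intros X Y Z U V W X' Y' Z' U' V' W' HX HY HZ HU HV HW.
    unfold differential, polar, px, py, pz; simpl fst; simpl snd.
    auto_derive.
    - repeat split; eexists; eassumption.
    - rewrite (is_derive_unique _ _ _ HX) (is_derive_unique _ _ _ HY)
        (is_derive_unique _ _ _ HZ) (is_derive_unique _ _ _ HU)
        (is_derive_unique _ _ _ HV) (is_derive_unique _ _ _ HW); field. }
  intros (Cx & Cy & Cz) (Dx & Dy & Dz).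
  exact (G _ _ _ _ _ _ _ _ _ _ _ _ Cx Cy Cz Dx Dy Dz).
Qed.

Lemma osculating_conditions (a b : Rbar) (s e : R -> vec) (u : R) (q : quadratic) :
  skew_ruled_surface a b s e -> in_Rbar_interval a b u ->
  osculating_quadric s e u q ->
  let x v := ruled s e u v in
  let x_u v := ruled (vDerive s) (vDerive e) u v in
  let x_uu v := ruled (vDerive (vDerive s)) (vDerive (vDerive e)) u v in
  forall v,
    qeval q (x v) = 0 /\ differential q (x v) (x_u v) = 0 /\
    2 * polar q (x_u v) (x_u v) + differential q (x v) (x_uu v) = 0.
Proof.
  intros HP Hu [_ Hq] x x_u x_uu v.
  pose proof (surface_regular a b s e (srs_C3 _ _ _ _ HP)) as Reg.
  assert (D1 : forall t, in_Rbar_interval a b t ->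
    is_vderive (fun r => ruled s e r v) t (ruled (vDerive s) (vDerive e) t v)).
  { intros t Ht; destruct (Reg t Ht) as [[S1 _] [E1 _]].
    exact (is_vderive_ruled _ _ t v _ _ S1 E1). }
  assert (D2 : is_vderive (fun r => ruled (vDerive s) (vDerive e) r v) u (x_uu v)).
  { destruct (Reg u Hu) as [[_ S2] [_ E2]].
    exact (is_vderive_ruled _ _ u v _ _ S2 E2). }
  split; [exact (Hq v 0%nat ltac:(lia)) |]; split.
  - rewrite -(Hq v 1%nat ltac:(lia)); symmetry.
    exact (is_derive_unique _ _ _ (is_derive_qeval q _ u _ (D1 u Hu))).
  - rewrite -(Hq v 2%nat ltac:(lia)); symmetry.
    apply is_derive_unique.
    apply (is_derive_ext_loc (fun t => differential q (ruled s e t v)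
      (ruled (vDerive s) (vDerive e) t v))).
    + generalize (locally_in_interval a b u Hu); apply filter_imp; intros t Ht.
      symmetry; exact (is_derive_unique _ _ _ (is_derive_qeval q _ t _ (D1 t Ht))).
    + exact (is_derive_differential q _ _ u _ _ (D1 u Hu) D2).
Qed.

Lemma quadratic_polynomial_coefficients (c0 c1 c2 : R) :
  (forall v, c0 + c1 * v + c2 * v ^ 2 = 0) -> c0 = 0 /\ c1 = 0 /\ c2 = 0.
Proof.
  intros H; generalize (H 0) (H 1) (H (-1)); intros; lra.
Qed.

(** The three contact conditions are polynomial identities in [v], and their
    nine coefficients determine the quadric up to the factor [c].  This is the
    equation of the osculating quadric of any skew ruled surface; its [yz] term
    disappears when the distribution parameter is stationary. *)
Lemma osculating_quadric_equation (a b : Rbar) (s e : R -> vec) (u : R) (q : quadratic) :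
  skew_ruled_surface a b s e -> in_Rbar_interval a b u ->
  osculating_quadric s e u q ->
  let k := conical_curvature e u in
  let d := drall s e u in
  let l := lambda s e u in
  exists c, forall x y z,
    qeval q (plus (s u) (in_frame (e u) (vDerive e u) x y z)) =
    c * (k * y ^ 2 + (k + l) * z ^ 2 + Derive (drall s e) u / d * (y * z)
         - 2 * (x * z) + 2 * d * y).
Proof.
  intros HP Hu Hq k d l.
  destruct (frame_equations a b s e u HP Hu) as (FR & Hs1 & He2 & Hs2 & _).
  fold k d l in Hs1, He2, Hs2.
  pose proof (srs_skew _ _ _ _ HP u Hu) as Hd; fold d in Hd.
  pose proof (osculating_conditions a b s e u q HP Hu Hq) as HC; unfold ruled in HC.
  rewrite Hs1 He2 Hs2 in HC.
  set (d' := Derive (drall s e) u) in *.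
  set (m := dot (vDerive (vDerive s) u) (e u)) in *.
  set (S := s u) in *; set (E := e u) in *; set (N := vDerive e u) in *.
  set (Z := cross E N).
  assert (Hx : forall v, plus S (scal v E) = plus S (in_frame E N v 0 0))
    by (intros v; unfold in_frame; vec_ring).
  assert (Hxu : forall v, plus (in_frame E N (d * l) 0 d) (scal v N)
    = in_frame E N (d * l) v d) by (intros v; unfold in_frame; vec_ring).
  assert (C0 : forall v, qeval q S + differential q S E * v + polar q E E * v ^ 2 = 0).
  { intros v; destruct (HC v) as [H _]; revert H; rewrite Hx qeval_plus
      differential_in_frame polar_in_frame; intros H; lra. }
  destruct (quadratic_polynomial_coefficients _ _ _ C0) as (H0 & HE & HEE).
  assert (C1 : forall v, d * differential q S Z
    + (differential q S N + 2 * d * polar q E Z) * v + 2 * polar q E N * v ^ 2 = 0).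
  { intros v; destruct (HC v) as [_ [H _]]; revert H.
    rewrite Hx Hxu differential_plus differential_in_frame polar_in_frame.
    fold Z; rewrite HE HEE; intros H; lra. }
  destruct (quadratic_polynomial_coefficients _ _ _ C1) as (HZ & HN & HEN).
  assert (HZ' : differential q S Z = 0) by nra.
  assert (C2 : forall v,
    2 * d ^ 2 * (polar q Z Z + (k + l) * polar q E Z)
    + 2 * (2 * d * polar q N Z + d' * polar q E Z) * v
    + 2 * (polar q N N + k * polar q E Z) * v ^ 2 = 0).
  { intros v; destruct (HC v) as [_ [_ H]]; revert H.
    rewrite Hx Hxu differential_plus in_frame_plus_scal differential_in_frame
      !polar_in_frame.
    fold Z; rewrite HE HEE HZ'.
    assert (HEN' : polar q E N = 0) by lra.
    assert (HN' : differential q S N = - 2 * d * polar q E Z) by lra.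
    rewrite HEN' HN'; intros H; lra. }
  destruct (quadratic_polynomial_coefficients _ _ _ C2) as (HZZ & HNZ & HNN).
  exists (- polar q E Z); intros x y z.
  rewrite qeval_plus differential_in_frame polar_in_frame; fold Z.
  assert (EZZ : polar q Z Z = - (k + l) * polar q E Z).
  { assert (0 < d ^ 2) by nra.
    apply Rmult_integral in HZZ; destruct HZZ; lra. }
  assert (ENZ : polar q N Z = - (d' / d) * polar q E Z / 2).
  { apply (Rmult_eq_reg_l (4 * d)); [| lra].
    transitivity (- 2 * d' * polar q E Z); [lra | field; exact Hd]. }
  assert (ENN : polar q N N = - k * polar q E Z) by lra.
  assert (EN' : differential q S N = - 2 * d * polar q E Z) by lra.
  assert (EEN : polar q E N = 0) by lra.
  rewrite H0 HE HEE HZ' EZZ ENZ ENN EN' EEN; field; exact Hd.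
Qed.

Lemma is_quadric_not_zero (q : quadratic) :
  is_quadric q -> ~ (forall p, qeval q p = 0).
Proof.
  intros Hq H; apply Hq.
  generalize (H (0, 0, 0)) (H (1, 0, 0)) (H (-1, 0, 0)) (H (0, 1, 0)) (H (0, -1, 0))
    (H (0, 0, 1)) (H (0, 0, -1)) (H (1, 1, 0)) (H (1, 0, 1)) (H (0, 1, 1)).
  unfold qeval, px, py, pz; simpl; intros; repeat split; lra.
Qed.

Lemma frame_coordinates (e n S p : vec) : orthonormal e n ->
  exists x y z, p = plus S (in_frame e n x y z).
Proof.
  intros H; exists (dot (minus p S) e), (dot (minus p S) n), (dot (minus p S) (cross e n)).
  rewrite -(frame_decomposition e n (minus p S) H); vec_ring.
Qed.

(** The quadratic part has the double eigenvalue [k], and the eigenvalue [-1/k]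
    along [k e + z], which is the direction of the axis.  Completing the square
    in [y] puts the centre at [S - (d/k) n]; the equation becomes
    [r^2 / (d/k)^2 - h^2 / d^2 = 1]. *)
Lemma hyperboloid_of_revolution_criterion (q : quadratic) (S e n : vec) (c k d : R) :
  orthonormal e n -> c <> 0 -> k <> 0 -> d <> 0 ->
  (forall x y z, qeval q (plus S (in_frame e n x y z)) =
     c * (k * y ^ 2 + (k - / k) * z ^ 2 - 2 * (x * z) + 2 * d * y)) ->
  hyperboloid_of_revolution q.
Proof.
  intros FR Hc Hk Hd Hq.
  set (r := sqrt (k ^ 2 + 1)).
  assert (Hr : 0 < r) by (apply sqrt_lt_R0; nra).
  assert (Hr2 : r ^ 2 = k ^ 2 + 1) by (apply pow2_sqrt; nra).
  exists (plus S (in_frame e n 0 (- (d / k)) 0)), (in_frame e n (k / r) 0 (/ r)),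
    (Rabs (d / k)), (Rabs d).
  split; [| split; [| split]].
  - unfold vnorm; rewrite (dot_in_frame _ _ _ _ _ _ _ _ FR).
    replace (k / r * (k / r) + 0 * 0 + / r * / r) with ((k ^ 2 + 1) / r ^ 2)
      by (field; lra).
    replace ((k ^ 2 + 1) / r ^ 2) with 1 by (rewrite Hr2; field; nra).
    apply sqrt_1.
  - apply Rabs_pos_lt; unfold Rdiv.
    apply Rmult_integral_contrapositive_currified;
      [exact Hd | apply Rinv_neq_0_compat; exact Hk].
  - apply Rabs_pos_lt; exact Hd.
  - intros p; destruct (frame_coordinates e n S p FR) as (x & y & z & ->).
    replace (minus (plus S (in_frame e n x y z)) (plus S (in_frame e n 0 (- (d / k)) 0)))
      with (in_frame e n x (y + d / k) z) by (unfold in_frame; vec_ring).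
    cbv zeta; rewrite !(dot_in_frame _ _ _ _ _ _ _ _ FR) !pow2_abs Hq.
    replace (x * (k / r) + (y + d / k) * 0 + z * / r) with ((k * x + z) / r)
      by (field; lra).
    assert (Hh : ((k * x + z) / r) ^ 2 = (k * x + z) ^ 2 / (k ^ 2 + 1))
      by (rewrite -Hr2; field; lra).
    rewrite Hh.
    set (P := k * y ^ 2 + (k - / k) * z ^ 2 - 2 * (x * z) + 2 * d * y).
    assert (EP : (x * x + (y + d / k) * (y + d / k) + z * z
        - (k * x + z) ^ 2 / (k ^ 2 + 1)) / (d / k) ^ 2
        - (k * x + z) ^ 2 / (k ^ 2 + 1) / d ^ 2 = 1 + k / d ^ 2 * P).
    { unfold P; field; repeat split; nra. }
    rewrite EP; split; intros H.
    + assert (P = 0) as -> by nra; ring.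
    + assert (HP : k / d ^ 2 * P = 0) by lra.
      apply Rmult_integral in HP; destruct HP as [HP | ->]; [| ring].
      exfalso; apply Hk.
      replace k with (k / d ^ 2 * d ^ 2) by (field; exact Hd); rewrite HP; ring.
Qed.

Lemma edlinger_criterion (a b : Rbar) (s e : R -> vec) :
  skew_ruled_surface a b s e -> constant_drall a b s e ->
  (forall u, in_Rbar_interval a b u ->
     1 + conical_curvature e u * lambda s e u = 0) ->
  edlinger a b s e.
Proof.
  intros HP Hd Hkl u Hu q Hq.
  destruct (frame_equations a b s e u HP Hu) as (FR & _).
  destruct (osculating_quadric_equation a b s e u q HP Hu Hq) as [c Hc].
  specialize (Hkl u Hu); rewrite (Hd u Hu) in Hc.
  pose proof (srs_skew _ _ _ _ HP u Hu) as Hdu.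
  set (k := conical_curvature e u) in *; set (l := lambda s e u) in *.
  assert (Hk : k <> 0) by (intros K; rewrite K in Hkl; lra).
  assert (Hl : l = - / k) by (apply (Rmult_eq_reg_l k); [| exact Hk]; field_simplify; lra).
  apply (hyperboloid_of_revolution_criterion q (s u) (e u) (vDerive e u) c k
    (drall s e u)); auto.
  - intros K; rewrite K in Hc; apply (is_quadric_not_zero q (proj1 Hq)); intros p.
    destruct (frame_coordinates (e u) (vDerive e u) (s u) p FR) as (x & y & z & ->).
    rewrite Hc; ring.
  - intros x y z; rewrite Hc Hl; field; auto.
Qed.

(** * From one generator to the interval *)

Lemma continuous_nonvanishing_sign (a b : Rbar) (h : R -> R) :
  (forall u, in_Rbar_interval a b u -> continuous h u) ->
  (forall u, in_Rbar_interval a b u -> h u <> 0) ->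
  forall x y, in_Rbar_interval a b x -> in_Rbar_interval a b y -> 0 < h x * h y.
Proof.
  intros Hc Hn.
  assert (W : forall x y, x < y -> in_Rbar_interval a b x -> in_Rbar_interval a b y ->
    0 < h x * h y).
  { intros x y Hxy Hx Hy.
    assert (HI : forall z, x <= z <= y -> in_Rbar_interval a b z).
    { intros z Hz; split.
      - apply (Rbar_lt_le_trans a x z); [apply Hx | apply Hz].
      - apply (Rbar_le_lt_trans z y b); [apply Hz | apply Hy]. }
    destruct (Rlt_le_dec 0 (h x * h y)) as [H | H]; [exact H | exfalso].
    pose proof (Hn x Hx) as Nx; pose proof (Hn y Hy) as Ny.
    destruct (IVT_interv (fun z => h y * h z) x y) as (z & Hz & H0).
    - intros z Hz; apply continuity_pt_mult;
        [apply continuity_pt_const; intros ? ?; reflexivity |].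
      apply continuity_pt_filterlim, Hc, HI, Hz.
    - exact Hxy.
    - assert (h x * h y <> 0) by (apply Rmult_integral_contrapositive_currified; auto).
      lra.
    - nra.
    - apply (Hn z (HI z Hz)); apply Rmult_integral in H0; destruct H0; tauto. }
  intros x y Hx Hy; destruct (Rtotal_order x y) as [H | [-> | H]]; auto.
  - generalize (Hn y Hy); intros; nra.
  - rewrite Rmult_comm; auto.
Qed.

Theorem proposition3
  (a b : Rbar) (hab : Rbar_lt a b)
  (s e : R -> vec) (hPhi : skew_ruled_surface a b s e)
  (n : Z) (f : R -> R)
  (hf : forall u : R, in_Rbar_interval a b u -> continuous f u)
  (hkN : forall u v : R, in_Rbar_interval a b u ->
     normal_curvature (ruled s e) u v 1 0
     = f u * powerRZ (sqrt (v ^ 2 + drall s e u ^ 2)) n) :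
  ((forall u : R, in_Rbar_interval a b u -> f u = 0) /\ right_helicoid a b s e)
  \/
  (n = (-1)%Z /\
   (forall u : R, in_Rbar_interval a b u -> f u = - conical_curvature e u) /\
   ((orthoid a b s e /\ constant_drall a b s e) \/ edlinger a b s e)).
Proof.
  set (I := in_Rbar_interval a b) in *.
  assert (P : forall u, I u -> Derive (drall s e) u = 0 /\
    ((f u = 0 /\ conical_curvature e u = 0 /\ lambda s e u = 0) \/
     (n = (-1)%Z /\ f u = - conical_curvature e u /\
      lambda s e u * (1 + conical_curvature e u * lambda s e u) = 0))).
  { intros u Hu; apply (power_law_coefficients _ (drall s e u)).
    - exact (srs_skew _ _ _ _ hPhi u Hu).
    - intros v; rewrite -(hkN u v Hu); symmetry.
      exact (normal_curvature_constant_distance a b s e u v hPhi Hu). }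
  destruct (Classical_Prop.classic (forall u, I u -> f u = 0)) as [F0 | F0].
  { left; split; [exact F0 |]; intros u Hu.
    destruct (P u Hu) as [Hd [(_ & Hk & Hl) | (_ & Hk & Hl)]]; [auto |].
    rewrite (F0 u Hu) in Hk; assert (K : conical_curvature e u = 0) by lra.
    rewrite K in Hl; repeat split; auto; lra. }
  right.
  assert (Hn : n = (-1)%Z).
  { destruct (Classical_Prop.classic (n = (-1)%Z)) as [H | H]; [exact H |].
    exfalso; apply F0; intros u Hu.
    destruct (P u Hu) as [_ [[H0 _] | [H0 _]]]; [exact H0 | contradiction]. }
  assert (Q : forall u, I u -> f u = - conical_curvature e u /\
    lambda s e u * (1 + conical_curvature e u * lambda s e u) = 0).
  { intros u Hu; destruct (P u Hu) as [_ [(Hf & Hk & Hl) | (_ & Hf & Hl)]]; [| auto].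
    rewrite Hf Hk Hl; split; ring. }
  assert (Cd : constant_drall a b s e) by (intros u Hu; apply P, Hu).
  split; [exact Hn |]; split; [intros u Hu; apply Q, Hu |].
  (* On this branch h = k l + 1/2, written with f because f is known to be
     continuous. *)
  set (h := fun u => / 2 - f u * lambda s e u).
  assert (Hh : forall u, I u -> continuous h u).
  { intros u Hu; apply: continuous_minus; [apply continuous_const |].
    apply (continuous_mult f (lambda s e) u); [exact (hf u Hu) |].
    destruct (frame_equations a b s e u hPhi Hu) as (_ & _ & _ & _ & Dl).
    exact (ex_derive_continuous (lambda s e) u Dl). }
  assert (Hv : forall u, I u -> (lambda s e u = 0 /\ h u = / 2) \/
    (1 + conical_curvature e u * lambda s e u = 0 /\ h u = - / 2)).
  { intros u Hu; destruct (Q u Hu) as [Hf Hl]; unfold h; rewrite Hf.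
    apply Rmult_integral in Hl; destruct Hl as [Hl | Hl];
      [left; rewrite Hl | right]; split; auto; lra. }
  pose proof (continuous_nonvanishing_sign a b h Hh
    (fun u Hu => ltac:(destruct (Hv u Hu) as [[_ ->] | [_ ->]]; lra))) as Sg.
  destruct (Classical_Prop.classic (orthoid a b s e)) as [Ho | Ho]; [left; auto | right].
  apply edlinger_criterion; auto; intros u Hu.
  destruct (Hv u Hu) as [[_ Hu'] | [H _]]; [exfalso | exact H].
  apply Ho; intros t Ht; destruct (Hv t Ht) as [[H _] | [_ Ht']]; [exact H |].
  generalize (Sg u t Hu Ht); rewrite Hu' Ht'; lra.
Qed.
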